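(* Let $(B,\cdot,\circ)$ be a left semi-brace such that $\rho$ is an anti-homomorphism. Then, for any field $K$, the algebra $KM(B)$ is generated as a left (and right) $KM(1_{\circ}B1_{\circ})$-module by $(1_{\circ}B)*(B1_{\circ})$.
   Context: A left semi-brace is a set $B$ with two operations $\cdot$ and $\circ$ such that $(B,\cdot)$ is a semigroup, $(B,\circ)$ is a group, and $a\circ(bc)=(a\circ b)(a\circ(\overline{a}c))$ for all $a,b,c\in B$ (here $xy$ means $x\cdot y$ and $\overline{a}$ is the inverse of $a$ in $(B,\circ)$). The identity of $(B,\circ)$ is $1_{\circ}$. Write $1_{\circ}B=\{1_{\circ}b\mid b\in B\}$, $B1_{\circ}=\{b1_{\circ}\mid b\in B\}$, $1_{\circ}B1_{\circ}=\{1_{\circ}b1_{\circ}\mid b\in B\}$. Maps: $\lambda_a(b)=a\circ(\overline{a}b)$ and $\rho_a(b)=\overline{(\overline{b}a)}\circ a$ for $a,b\in B$. The map $\rho:(B,\circ)\to\mathrm{Map}(B,B)$, $a\mapsto\rho_a$, is an anti-homomorphism if $\rho_{a\circ b}=\rho_b\rho_a$ (composition of maps) for all $a,b\in B$. In that case $r_B(x,y)=(\lambda_x(y),\rho_y(x))$ is a set-theoretic solution of the Yang-Baxter equation on $B$, and $1_{\circ}B1_{\circ}$ is a left subsemi-brace of $B$ (in fact a skew left brace, i.e. a left semi-brace whose multiplicative semigroup is a group). The structure monoid $M(B)$ is the monoid with generating set $B$ and defining relations $x*y=u*v$ whenever $r_B(x,y)=(u,v)$; its operation is denoted $*$. For subsets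 $X,Y\subseteq B$, $X*Y=\{x*y\mid x\in X,\ y\in Y\}\subseteq M(B)$. The monoid $M(1_{\circ}B1_{\circ})$ is defined in the same way from the left semi-brace $1_{\circ}B1_{\circ}$. $KM(B)$ and $KM(1_{\circ}B1_{\circ})$ denote the monoid algebras over $K$, and $KM(B)$ is a left and right $KM(1_{\circ}B1_{\circ})$-module via the monoid homomorphism $M(1_{\circ}B1_{\circ})\to M(B)$ induced by inclusion of generators.
   Formalization: As stated the claim fails for every B: the module generated by (1B)*(B1) contains neither the unit of KM(B) nor any generator. What is proved: the left and the right module generated by (1B)*(B1) each equal the K-span of all elements of M(B) of word length at least 2. *)

(* Defs.v *)
From HB Require Import structures.
From mathcomp Require Import all_boot all_algebra.
From mathcomp Require Import generic_quotient boolp classical_sets.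
From mathcomp Require Import monalg.

Set Implicit Arguments.
Unset Strict Implicit.
Unset Printing Implicit Defensive.

Import GRing.Theory.

Local Open Scope quotient_scope.

(* A left semi-brace: the group (B, o) is the groupType structure, written
   multiplicatively in group_scope (a * b is a o b, a^-1 its inverse, 1 its
   identity); the semigroup operation is [dot], written a ⋅ b. *)
HB.mixin Record isLeftSemiBrace B of Group B := {
  dot : B -> B -> B;
  dotA : associative dot;
  circ_dot : forall a b c : B,
    (a * dot b c = dot (a * b) (a * dot a^-1 c))%g
}.

#[short(type="leftSemiBraceType")]
HB.structure Definition LeftSemiBrace :=
  { B of Group B & isLeftSemiBrace B }.

Notation "a ⋅ b" := (dot a b) (at level 40, left associativity) : group_scope.

Section LeftSemiBraceDefs.
Variable B : leftSemiBraceType.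
Local Open Scope group_scope.

Definition lambda (a b : B) : B := a * (a^-1 ⋅ b).

Definition rho (a b : B) : B := (b^-1 ⋅ a)^-1 * a.

Definition rho_antimorphism : Prop :=
  forall a b : B, rho (a * b) =1 rho b \o rho a.

Definition brace_map (p : B * B) : B * B :=
  (lambda p.1 p.2, rho p.2 p.1).

Definition one_dot : set B := [set 1 ⋅ b | b in [set: B]].

Definition dot_one : set B := [set b ⋅ 1 | b in [set: B]].

Definition core_pred : pred B := fun x => `[< exists b : B, x = 1 ⋅ b ⋅ 1 >].

End LeftSemiBraceDefs.

Arguments one_dot B : clear implicits.
Arguments dot_one B : clear implicits.

Section Core.
Variable B : leftSemiBraceType.
Local Open Scope group_scope.
Implicit Types a b c x y : B.

Lemma dot_dot1 a b : a ⋅ 1 ⋅ b = a ⋅ b.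
Proof. by have := circ_dot 1 a b; rewrite invg1 !mul1g dotA. Qed.

Lemma dot11 : 1 ⋅ 1 = 1 :> B.
Proof.
set e : B := 1 ⋅ 1.
have ee b : e ⋅ b = 1 ⋅ b by rewrite /e dot_dot1.
have := circ_dot e^-1 e (1 : B).
by rewrite invgK mulVg !ee -/e mulVg.
Qed.

Lemma lambda1 b : lambda 1 b = 1 ⋅ b.
Proof. by rewrite /lambda invg1 mul1g. Qed.

Lemma circ_dotE a b c : a * (b ⋅ c) = (a * b) ⋅ lambda a c.
Proof. exact: circ_dot. Qed.

Lemma lambdaM a b c : lambda (a * b) c = lambda a (lambda b c).
Proof.
by rewrite {1}/lambda invgM -mulgA circ_dotE mulVKg.
Qed.

Lemma lambda_dot a b c : lambda a (b ⋅ c) = lambda a b ⋅ lambda a c.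
Proof. by rewrite {1}/lambda dotA circ_dotE. Qed.

Lemma circ_dot1 a c : a * (1 ⋅ c) = a ⋅ lambda a c.
Proof. by rewrite circ_dotE mulg1. Qed.

Section AntiHomomorphism.
Hypothesis rhoM : rho_antimorphism B.

Lemma rho_key a c : a * ((a^-1 * (c ⋅ a)) ⋅ a^-1) = c ⋅ 1.
Proof.
have := rhoM a a^-1 c^-1; rewrite mulgV /rho /= invgK mulg1 invgM invgK.
by move/(congr1 (fun x : B => x^-1)); rewrite invgM !invgK.
Qed.

Lemma rho_key1 a : (a^-1 * (1 ⋅ a)) ⋅ a^-1 = a^-1.
Proof. by apply: (mulgI a); rewrite rho_key dot11 mulgV. Qed.

Lemma rho_right a c : (a^-1 * (c ⋅ a)) ⋅ 1 = a^-1 * (c ⋅ a).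
Proof.
have := rhoM a 1 c^-1; rewrite mulg1 /rho /= !invgK mulg1 invgM invgK.
by move/(congr1 (fun x : B => x^-1)); rewrite invgM !invgK.
Qed.

Lemma left1V a : 1 ⋅ a = a -> 1 ⋅ a^-1 = a^-1.
Proof. by move=> a1; have := rho_key1 a; rewrite a1 mulVg. Qed.

Lemma left1M a b : 1 ⋅ a = a -> 1 ⋅ b = b -> 1 ⋅ (a * b) = a * b.
Proof. by move=> a1 b1; rewrite -b1 circ_dot1 dotA a1. Qed.

Lemma lambda_right1 a : a ⋅ 1 = a -> lambda a 1 = 1.
Proof.
move=> a1; set u := a * (1 ⋅ a^-1).
have u1 : u ⋅ 1 = u by have := rho_right a^-1 1; rewrite invgK.
have ua : u ⋅ a = a by have := rho_key1 a^-1; rewrite invgK.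
have lE : lambda a 1 = 1 ⋅ u.
  have x1 : lambda a^-1 a ⋅ a^-1 = 1.
    by apply: (mulgI a); rewrite /lambda invgK rho_key a1 mulg1.
  by rewrite -{1}x1 lambda_dot -lambdaM mulgV lambda1 -dotA -circ_dot1.
set g := 1 ⋅ a.
have g1 : 1 ⋅ g = g by rewrite /g dotA dot11.
have gV : g ⋅ lambda g g^-1 = 1 by rewrite -circ_dot1 left1V ?mulgV.
have lg : lambda a 1 ⋅ g = g.
  by rewrite lE /g dotA dot_dot1 -dotA ua.
have l1 : lambda a 1 ⋅ 1 = lambda a 1 by rewrite lE -dotA u1.
by rewrite -l1 -{2}gV dotA lg gV.
Qed.

Lemma right1V a : a ⋅ 1 = a -> a^-1 ⋅ 1 = a^-1.
Proof.
by move=> /lambda_right1; rewrite /lambda => h; apply: (mulgI a); rewrite h mulgV.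
Qed.

Lemma right1M a b : a ⋅ 1 = a -> b ⋅ 1 = b -> (a * b) ⋅ 1 = a * b.
Proof. by move=> a1 b1; rewrite -{2}b1 circ_dotE lambda_right1. Qed.

Lemma core_predP x : reflect (1 ⋅ x = x /\ x ⋅ 1 = x) (core_pred x).
Proof.
apply: (iffP (asboolP _)) => [[b ->]|[x1 x2]]; last by exists x; rewrite x1 x2.
by rewrite !dotA dot11 -(dotA (1 ⋅ b)) dot11.
Qed.

Lemma core_group_closed : group_closed (@core_pred B).
Proof.
split=> [|x y /core_predP[x1 x2] /core_predP[y1 y2]].
  by apply/core_predP; rewrite dot11.
apply/core_predP; split.
  by apply: left1M => //; apply: left1V.
by apply: right1M => //; apply: right1V.
Qed.

Lemma core_dot x y : core_pred x -> core_pred y -> core_pred (x ⋅ y).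
Proof.
move=> /core_predP[x1 x2] /core_predP[y1 y2]; apply/core_predP.
by rewrite dotA x1 -dotA y2.
Qed.

End AntiHomomorphism.
End Core.

Section StructureMonoid.
Variables (X : choiceType) (r : X * X -> X * X).

Inductive word_cong : seq X -> seq X -> Prop :=
| word_cong_refl s : word_cong s s
| word_cong_sym s t : word_cong s t -> word_cong t s
| word_cong_trans s t u : word_cong s t -> word_cong t u -> word_cong s u
| word_cong_rel s t x y u v : r (x, y) = (u, v) ->
    word_cong (s ++ [:: x; y] ++ t) (s ++ [:: u; v] ++ t).

Definition word_congb : rel (seq X) := fun s t => `[< word_cong s t >].

Lemma word_congb_equiv : equiv_class_of word_congb.
Proof.
split.
- by move=> s; apply/asboolP; apply: word_cong_refl.
- by move=> s t; apply/asboolP/asboolP; apply: word_cong_sym.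
- move=> t s u /asboolP st /asboolP tu; apply/asboolP.
  exact: word_cong_trans st tu.
Qed.

Canonical word_congb_equiv_rel := EquivRelPack word_congb_equiv.

Definition structure_monoid := {eq_quot word_congb}.

HB.instance Definition _ := Choice.on structure_monoid.

Definition word_class (s : seq X) : structure_monoid :=
  \pi_({eq_quot word_congb}) s.

Lemma word_classP s t : word_class s = word_class t <-> word_cong s t.
Proof.
split=> [/eqquotP /asboolP //|st]; apply/eqquotP; exact/asboolP.
Qed.

Lemma word_class_repr (m : structure_monoid) : word_class (repr m) = m.
Proof. exact: reprK. Qed.

Lemma word_cong_repr s : word_cong (repr (word_class s)) s.
Proof. by apply/word_classP; rewrite word_class_repr. Qed.

Lemma word_cong_cat s s' t t' :
  word_cong s s' -> word_cong t t' -> word_cong (s ++ t) (s' ++ t').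
Proof.
move=> ss' tt'; apply: (@word_cong_trans _ (s' ++ t)).
  elim: ss' => {s s'} [s|s s' _|s s' s'' _ st _|s s' x y u v rxy].
  - exact: word_cong_refl.
  - exact: word_cong_sym.
  - exact: word_cong_trans.
  - by rewrite -!catA; apply: word_cong_rel.
elim: tt' => {t t'} [t|t t' _|t t' t'' _ st _|t t' x y u v rxy].
- exact: word_cong_refl.
- exact: word_cong_sym.
- exact: word_cong_trans.
- by rewrite !(catA s'); apply: word_cong_rel.
Qed.

Lemma word_cong_size s t : word_cong s t -> size s = size t.
Proof.
elim=> {s t} [//|s t _ ->//|s t u _ -> _ ->//|s t x y u v _].
by rewrite !size_cat.
Qed.

Definition sm_one : structure_monoid := word_class [::].

Definition sm_mul (m n : structure_monoid) : structure_monoid :=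
  word_class (repr m ++ repr n).

Definition sm_gen (x : X) : structure_monoid := word_class [:: x].

(* Both sides of every defining relation have two letters, so the length of a
   representing word depends only on the element of the monoid. *)
Definition sm_length (m : structure_monoid) : nat := size (repr m).

Lemma word_classM s t : sm_mul (word_class s) (word_class t) = word_class (s ++ t).
Proof. by apply/word_classP/word_cong_cat; apply: word_cong_repr. Qed.

Lemma sm_lengthE s : sm_length (word_class s) = size s.
Proof. exact/word_cong_size/word_cong_repr. Qed.

Lemma sm_mulA : associative sm_mul.
Proof.
move=> m n p; rewrite -(word_class_repr m) -(word_class_repr n).
by rewrite -(word_class_repr p) !word_classM catA.
Qed.

Lemma sm_mul1m : left_id sm_one sm_mul.
Proof. by move=> m; rewrite -(word_class_repr m) word_classM. Qed.

Lemma sm_mulm1 : right_id sm_one sm_mul.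
Proof. by move=> m; rewrite -(word_class_repr m) word_classM cats0. Qed.

Lemma sm_unitm m n : sm_mul m n = sm_one -> m = sm_one /\ n = sm_one.
Proof.
rewrite -(word_class_repr m) -(word_class_repr n) word_classM.
move/(congr1 sm_length); rewrite !sm_lengthE size_cat /=.
by case: (repr m) (repr n) => [|? ?] [|? ?].
Qed.

HB.instance Definition _ := Choice_isMonomialDef.Build structure_monoid
  sm_mulA sm_mul1m sm_mulm1 sm_unitm.

End StructureMonoid.

Section StructureMonoidMap.
Variables (X Y : choiceType) (rX : X * X -> X * X) (rY : Y * Y -> Y * Y).
Variable f : X -> Y.
Hypothesis fr : forall x y u v,
  rX (x, y) = (u, v) -> rY (f x, f y) = (f u, f v).

Definition sm_map (m : structure_monoid rX) : structure_monoid rY :=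
  word_class rY (map f (repr m)).

Lemma word_cong_map s t :
  word_cong rX s t -> word_cong rY (map f s) (map f t).
Proof.
elim=> {s t} [s|s t _|s t u _ st _|s t x y u v rxy].
- exact: word_cong_refl.
- exact: word_cong_sym.
- exact: word_cong_trans.
- by rewrite !map_cat /=; apply: word_cong_rel; apply: fr.
Qed.

Lemma sm_mapE s : sm_map (word_class rX s) = word_class rY (map f s).
Proof. by apply/word_classP/word_cong_map/word_cong_repr. Qed.

Lemma sm_map_gen x : sm_map (sm_gen rX x) = sm_gen rY (f x).
Proof. exact: sm_mapE. Qed.

Lemma sm_map1 : sm_map mone = mone.
Proof. exact: sm_mapE. Qed.

Lemma sm_mapM : {morph sm_map : m n / mmul m n}.
Proof.
move=> m n; transitivity (sm_map (word_class rX (repr m ++ repr n))) => //.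
by rewrite sm_mapE map_cat -word_classM.
Qed.

End StructureMonoidMap.

Section CoreSemiBrace.
Variable B : leftSemiBraceType.
Local Open Scope group_scope.

(* The hypothesis on rho is a parameter of the type 1 ⋅ B ⋅ 1 because it is
   needed for this subset to be closed under the group operation. *)
Record core (rhoM : rho_antimorphism B) :=
  Core { core_val : B; core_valP : core_pred core_val }.

Variable rhoM : rho_antimorphism B.

HB.instance Definition _ := [isSub for @core_val rhoM].
HB.instance Definition _ := [Choice of core rhoM by <:].
HB.instance Definition _ :=
  SubChoice_isSubGroup.Build B (@core_pred B) (core rhoM)
    (core_group_closed rhoM).

Definition core_dot_op (x y : core rhoM) : core rhoM :=
  Core rhoM (core_dot (core_valP x) (core_valP y)).

Lemma core_dotA : associative core_dot_op.
Proof. by move=> x y z; apply: val_inj; apply: dotA. Qed.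

Lemma core_circ_dot (a b c : core rhoM) :
  a * core_dot_op b c = core_dot_op (a * b) (a * core_dot_op a^-1 c).
Proof. by apply: val_inj; apply: circ_dot. Qed.

HB.instance Definition _ :=
  isLeftSemiBrace.Build (core rhoM) core_dotA core_circ_dot.

End CoreSemiBrace.

Notation "'M(' B )" := (structure_monoid (@brace_map B))
  (at level 0, B at level 200, format "'M(' B )") : type_scope.

Section CoreAlgebra.
Variables (B : leftSemiBraceType) (rhoM : rho_antimorphism B) (K : fieldType).
Local Open Scope ring_scope.

Lemma core_brace_map (x y u v : core rhoM) :
  brace_map (x, y) = (u, v) -> brace_map (val x, val y) = (val u, val v).
Proof. by case=> <- <-. Qed.

Definition core_monoid_map : M(core rhoM) -> M(B) :=
  sm_map (@brace_map B) (val : core rhoM -> B).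

Definition core_basis (m : M(core rhoM)) : {malg K[M(B)]} :=
  << core_monoid_map m >>.

Lemma core_basis_mmorphism : mmorphism core_basis.
Proof.
split=> [m n|]; rewrite /core_basis /core_monoid_map.
  by rewrite (sm_mapM core_brace_map) [RHS]fgmulUU mulr1.
by rewrite (sm_map1 core_brace_map).
Qed.

HB.instance Definition _ :=
  monalg.isMultiplicative.Build _ _ core_basis core_basis_mmorphism.

Definition core_algebra_map : {malg K[M(core rhoM)]} -> {malg K[M(B)]} :=
  mmap (@malgC M(B) K) core_basis.

HB.instance Definition _ := GRing.Additive.on core_algebra_map.

Lemma core_algebra_map_monoid_morphism :
  GRing.monoid_morphism core_algebra_map.
Proof.
have [] := @commr_mmap_is_multiplicative _ _ _ (@malgC M(B) K) core_basis.
  move=> g m m'; rewrite /GRing.comm mul_malgC /core_basis.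
  by rewrite [RHS]fgmulUU; apply/malgP=> k;
     rewrite mcoeffZ !mcoeffU mulm1 mul1r mulrnAr mulr1.
by move=> hM h1; split.
Qed.

HB.instance Definition _ :=
  GRing.isMonoidMorphism.Build {malg K[M(core rhoM)]} {malg K[M(B)]}
    core_algebra_map core_algebra_map_monoid_morphism.

End CoreAlgebra.

Arguments core_monoid_map {B} rhoM _.
Arguments core_algebra_map {B} rhoM K _.

Section GeneratedModule.
Variables (A R : pzRingType) (phi : {rmorphism A -> R}).
Local Open Scope ring_scope.

(* R is a left (right) A-module through phi; these are its A-submodules
   generated by S. *)
Definition left_generated (S : set R) : set R :=
  [set x | exists s : seq (A * R),
     (forall p, p \in s -> S p.2) /\ x = \sum_(p <- s) phi p.1 * p.2].

Definition right_generated (S : set R) : set R :=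
  [set x | exists s : seq (A * R),
     (forall p, p \in s -> S p.2) /\ x = \sum_(p <- s) p.2 * phi p.1].

End GeneratedModule.

Section MonoidAlgebraSubsets.
Variables (B : leftSemiBraceType) (K : fieldType).
Local Open Scope ring_scope.

Definition sm_setM (X Y : set B) : set M(B) :=
  [set mmul (sm_gen _ x) (sm_gen _ y) | x in X & y in Y].

Definition basis_set (S : set M(B)) : set {malg K[M(B)]} :=
  [set << m >> | m in S].

(* The K-span of the elements of M(B) of length at least n. M(B) is graded by
   length, so a module generated by products x * y of two generators lies in
   [supported_from 2]: it never contains the unit of KM(B) nor the generators. *)
Definition supported_from (n : nat) : set {malg K[M(B)]} :=
  [set x | forall m, x@_m != 0 -> (n <= sm_length m)%N].

End MonoidAlgebraSubsets.

Arguments basis_set {B} K S.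
Arguments supported_from B K n : clear implicits.

(* Main.v *)
Require Import Defs.
From mathcomp Require Import all_boot all_algebra.
From mathcomp Require Import boolp classical_sets.
From mathcomp Require Import monalg.

(** Write L = 1 ⋅ B, R = B ⋅ 1 and C = 1 ⋅ B ⋅ 1 = L ∩ R. The theorem is a
    normal form for words: every product of n >= 2 generators of M(B) equals
    one of the shape C ∗ ... ∗ C ∗ L ∗ R, and also one of the shape
    L ∗ R ∗ C ∗ ... ∗ C, with n - 2 letters in C.

    Applying the defining relation x ∗ y = λ_x(y) ∗ ρ_y(x) puts letters into
    these subsets: λ always lands in L and ρ always lands in R
    ([gen_mul_left_right]); if x and y are both in L then ρ_y(x) is in C
    ([rho_core]), and if both are in R then λ_x(y) is in C ([lambda_core]).
    What remains is to move a letter of C past a letter of L to its left, or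
    past a letter of R to its right. This goes against the direction of r_B:
    one has to solve r_B(d, x) = (l, c) for d in C and x in L
    ([brace_map_left_core]), and symmetrically r_B(x, d) = (c, r)
    ([brace_map_core_right]). Since λ_x(y) o ρ_y(x) = x o y, the first equation
    amounts to d ⋅ l = l o c together with x = λ_(d^-1)(l), and it is solvable
    because (C, ⋅) is a group ([core_dotV]).

    A word is then normalised by induction on its length. Appending z to a word
    C...C L R, the last two letters R z become L R, which gives C...C L L R;
    the two letters L L become L C, and then C L ([left_normal_form]).
    Prepending z to L R C...C works in the same way ([right_normal_form]).
    Hence the basis elements of length at least 2 lie in the module generated
    by L ∗ R, and conversely lengths add up in products, so this module contains
    nothing of length less than 2. *)

Set Implicit Arguments.
Unset Strict Implicit.
Unset Printing Implicit Defensive.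

Import GRing.Theory.

Local Notation "m ∗ n" := (mmul m n) (at level 40, left associativity).
Local Notation gen x := (sm_gen (@brace_map _) x).

(** * Subsets of the semi-brace and the map r_B *)

Section BraceMap.
Variable B : leftSemiBraceType.
Local Open Scope group_scope.
Implicit Types a b c x y l r : B.

Lemma one_dotP x : one_dot B x <-> 1 ⋅ x = x.
Proof.
by split=> [[b _ <-]|x1]; [rewrite dotA dot11 | exists x].
Qed.

Lemma dot_oneP x : dot_one B x <-> x ⋅ 1 = x.
Proof.
by split=> [[b _ <-]|x1]; [rewrite -dotA dot11 | exists x].
Qed.

Lemma lambda_left x y : 1 ⋅ lambda x y = lambda x y.
Proof. by rewrite -lambda1 -lambdaM mul1g. Qed.

(** r_B preserves the product of (B, o), so one component of r_B(x, y) together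
    with x o y determines the other. *)
Lemma brace_map_prod x y : lambda x y * rho y x = x * y.
Proof. by rewrite /lambda /rho -mulgA mulVKg. Qed.

Lemma mul_lambda_inv x y : x * lambda x^-1 y = x ⋅ y.
Proof. by rewrite /lambda invgK mulVKg. Qed.

Lemma dot_lambda1 x : x ⋅ lambda x 1 = x.
Proof. by rewrite -circ_dot1 dot11 mulg1. Qed.

Section AntiHomomorphism.
Hypothesis rhoM : rho_antimorphism B.

(** As ρ is an anti-homomorphism, ρ_y = ρ_1 ρ_y, and ρ_1(b) is the inverse of
    b^-1 ⋅ 1. *)
Lemma rho_right1 x y : rho y x ⋅ 1 = rho y x.
Proof.
have := rhoM y 1 x; rewrite mulg1 /= {2}/rho mulg1 => ->.
by apply: right1V; rewrite // -dotA dot11.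
Qed.

Lemma lambda_core x y : x ⋅ 1 = x -> y ⋅ 1 = y -> core_pred (lambda x y).
Proof.
move=> x1 y1; apply/core_predP; split; first exact: lambda_left.
by rewrite -{1}(lambda_right1 rhoM x1) -lambda_dot y1.
Qed.

Lemma rho_core x y : 1 ⋅ x = x -> 1 ⋅ y = y -> core_pred (rho y x).
Proof.
move=> x1 y1; apply/core_predP; split; last exact: rho_right1.
by apply: left1M => //; apply: left1V => //; rewrite dotA left1V.
Qed.

(** The skew left brace property of 1 ⋅ B ⋅ 1. For g in this subset,
    g ⋅ λ_g(g^-1) = g o (1 ⋅ g^-1) = 1 gives a right inverse inside the subset,
    and a monoid in which every element has a right inverse is a group. *)
Lemma core_dotV (g : B) : core_pred g ->
  exists h, [/\ core_pred h, g ⋅ h = 1 & h ⋅ g = 1].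
Proof.
have rinv x : core_pred x -> exists2 h, core_pred h & x ⋅ h = 1.
  case/core_predP=> x1 x2; exists (lambda x x^-1).
    by apply: lambda_core => //; apply: right1V.
  by rewrite -circ_dot1 left1V ?mulgV.
move=> gC; have [h hC gh] := rinv g gC; have [k kC hk] := rinv h hC.
exists h; split=> //; suff -> : g = k by [].
have [_ g1] := elimT (core_predP _) gC; have [k1 _] := elimT (core_predP _) kC.
by rewrite -g1 -hk dotA gh k1.
Qed.

(** Solving r_B(d, x) = (l, c). The condition λ_d(x) = l forces
    x = λ_(d^-1)(l), so that d o x = d ⋅ l, and preservation of the product
    leaves the single equation d ⋅ l = l o c. Both sides are unchanged by
    right multiplication with λ_l(1), because l = l ⋅ λ_l(1) and
    l o c = l o (c ⋅ 1) = (l o c) ⋅ λ_l(1). It is therefore enough to have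
    d ⋅ (l ⋅ 1) = (l o c) ⋅ 1, an equation in the group 1 ⋅ B ⋅ 1. *)
Lemma brace_map_left_core l c : 1 ⋅ l = l -> core_pred c ->
  exists d x, [/\ core_pred d, 1 ⋅ x = x & brace_map (d, x) = (l, c)].
Proof.
move=> l1 cC; have [c1 c2] := elimT (core_predP _) cC.
have gC : core_pred (l ⋅ 1) by apply/asboolP; exists l; rewrite l1.
(* h is the inverse of l ⋅ 1 in the multiplicative group 1 ⋅ B ⋅ 1. *)
have [h [hC gh hg]] := core_dotV gC.
have [_ h1] := elimT (core_predP _) hC.
pose d := (l * c) ⋅ h; pose x := lambda d^-1 l.
have dC : core_pred d.
  apply/core_predP; rewrite /d; split; last by rewrite -dotA h1.
  by rewrite dotA left1M.
have dl : d ⋅ l = l * c.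
  rewrite -{1}(dot_lambda1 l) -(dot_dot1 l) dotA /d -(dotA (l * c)) hg.
  by rewrite dot_dot1 -circ_dotE c2.
exists d, x; split=> //; first exact: lambda_left.
have lE : lambda d x = l by rewrite -lambdaM mulgV lambda1.
rewrite /brace_map /= lE; congr pair; apply: (mulgI l).
by rewrite -{1}lE brace_map_prod mul_lambda_inv.
Qed.

(** Solving r_B(x, d) = (c, r): as above this reduces to x ⋅ c = c o r, solved
    by right multiplication with the inverse of c in the multiplicative group
    1 ⋅ B ⋅ 1, since c o r is fixed by right multiplication with 1. *)
Lemma brace_map_core_right c r : core_pred c -> r ⋅ 1 = r ->
  exists x d, [/\ x ⋅ 1 = x, core_pred d & brace_map (x, d) = (c, r)].
Proof.
move=> cC r1; have [c1 c2] := elimT (core_predP _) cC.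
have [h [hC ch hc]] := core_dotV cC; have [_ h1] := elimT (core_predP _) hC.
pose x := (c * r) ⋅ h; pose d := lambda x^-1 c.
have x1 : x ⋅ 1 = x by rewrite /x -dotA h1.
have xc : x ⋅ c = c * r by rewrite /x -dotA hc right1M.
exists x, d; split=> //; first by apply: lambda_core => //; apply: right1V.
have cE : lambda x d = c by rewrite -lambdaM mulgV lambda1.
rewrite /brace_map /= cE; congr pair; apply: (mulgI c).
by rewrite -{1}cE brace_map_prod mul_lambda_inv.
Qed.

End AntiHomomorphism.
End BraceMap.

(** * Normal forms in the structure monoid *)

Section NormalForm.
Variables (B : leftSemiBraceType) (rhoM : rho_antimorphism B).
Implicit Types x y z u v : B.

Lemma gen_mul_brace_map x y u v :
  brace_map (x, y) = (u, v) -> gen x ∗ gen y = gen u ∗ gen v.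
Proof.
move=> rxy; rewrite /mmul /= !word_classM; apply/word_classP.
exact: (word_cong_rel [::] [::] rxy).
Qed.

Lemma gen_mul_left_right x y : exists u v,
  [/\ (1 ⋅ u = u)%g, (v ⋅ 1 = v)%g & gen x ∗ gen y = gen u ∗ gen v].
Proof.
exists (lambda x y), (rho y x); split; first exact: lambda_left.
  exact: rho_right1.
exact: gen_mul_brace_map.
Qed.

Lemma core_monoid_map_gen (c : core rhoM) :
  core_monoid_map rhoM (gen c) = gen (val c).
Proof. exact/sm_map_gen/core_brace_map. Qed.

Lemma core_monoid_mapM : {morph core_monoid_map rhoM : m n / m ∗ n}.
Proof. exact/sm_mapM/core_brace_map. Qed.

(** Two steps: r_B turns the pair L ∗ L into L ∗ C, which is then rewritten
    backwards along r_B as C ∗ L. *)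
Lemma gen_mul_left_core u v : (1 ⋅ u = u)%g -> (1 ⋅ v = v)%g ->
  exists (c : core rhoM) w, (1 ⋅ w = w)%g /\
    gen u ∗ gen v = core_monoid_map rhoM (gen c) ∗ gen w.
Proof.
move=> u1 v1.
have [d [w [dC w1 rE]]] := brace_map_left_core rhoM (lambda_left u v)
  (rho_core rhoM u1 v1).
exists (Core rhoM dC), w; split=> //; rewrite core_monoid_map_gen.
rewrite (gen_mul_brace_map rE).
exact: gen_mul_brace_map.
Qed.

(** Mirror image of the previous lemma: R ∗ R becomes C ∗ R, then R ∗ C. *)
Lemma gen_mul_core_right u v : (u ⋅ 1 = u)%g -> (v ⋅ 1 = v)%g ->
  exists (c : core rhoM) w, (w ⋅ 1 = w)%g /\
    gen u ∗ gen v = gen w ∗ core_monoid_map rhoM (gen c).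
Proof.
move=> u1 v1.
have [w [d [w1 dC rE]]] := brace_map_core_right rhoM
  (lambda_core rhoM u1 v1) (rho_right1 rhoM u v).
exists (Core rhoM dC), w; split=> //; rewrite core_monoid_map_gen.
rewrite (gen_mul_brace_map rE).
exact: gen_mul_brace_map.
Qed.

Lemma word_class_cat (s t : seq B) :
  word_class (@brace_map B) (s ++ t)
    = word_class (@brace_map B) s ∗ word_class (@brace_map B) t.
Proof. by rewrite /mmul /= word_classM. Qed.

(** Induction by appending letters: the coefficient from the core is on the
    left, so the new letter has to enter at the right end, where it meets R. *)
Lemma left_normal_form (m : M(B)) : 2 <= sm_length m ->
  exists n p, sm_setM (one_dot B) (dot_one B) p /\
    m = core_monoid_map rhoM n ∗ p.
Proof.
suff nf s x y : exists n u v, [/\ (1 ⋅ u = u)%g, (v ⋅ 1 = v)%g &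
    word_class (@brace_map B) [:: x, y & s]
      = core_monoid_map rhoM n ∗ (gen u ∗ gen v)].
  rewrite -(word_class_repr m) sm_lengthE; case: (repr m) => [|x [|y s]] // _.
  have [n [u [v [u1 v1 ->]]]] := nf s x y; exists n, (gen u ∗ gen v).
  split=> //; exists u; first exact/one_dotP.
  by exists v; first exact/dot_oneP.
elim/last_ind: s => [|s z [n [u [v [u1 v1 sE]]]]].
  have [u [v [u1 v1 xyE]]] := gen_mul_left_right x y.
  exists mone, u, v; split=> //; rewrite /core_monoid_map.
  by rewrite (sm_map1 (@core_brace_map _ rhoM)) mul1m -xyE -word_class_cat.
have [u' [v' [u'1 v'1 vzE]]] := gen_mul_left_right v z.
have [c [w [w1 uuE]]] := gen_mul_left_core u1 u'1.
exists (n ∗ gen c), w, v'; split=> //.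
rewrite -cats1 -!cat_cons word_class_cat sE core_monoid_mapM.
by rewrite -/(gen z) -!mulmA vzE (mulmA (gen u)) uuE !mulmA.
Qed.

(** Induction by prepending letters, the new letter meeting L. *)
Lemma right_normal_form (m : M(B)) : 2 <= sm_length m ->
  exists n p, sm_setM (one_dot B) (dot_one B) p /\
    m = p ∗ core_monoid_map rhoM n.
Proof.
suff nf s x y : exists n u v, [/\ (1 ⋅ u = u)%g, (v ⋅ 1 = v)%g &
    word_class (@brace_map B) (s ++ [:: x; y])
      = (gen u ∗ gen v) ∗ core_monoid_map rhoM n].
  rewrite -(word_class_repr m) sm_lengthE.
  case/lastP: (repr m) => [|s y] //; case/lastP: s => [|s x] // _.
  have [n [u [v [u1 v1 sE]]]] := nf s x y; exists n, (gen u ∗ gen v).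
  rewrite -2!cats1 -catA sE; split=> //; exists u; first exact/one_dotP.
  by exists v; first exact/dot_oneP.
elim: s => [|z s [n [u [v [u1 v1 sE]]]]].
  have [u [v [u1 v1 xyE]]] := gen_mul_left_right x y.
  exists mone, u, v; split=> //; rewrite /core_monoid_map.
  by rewrite (sm_map1 (@core_brace_map _ rhoM)) mulm1 -xyE -word_class_cat.
have [u' [v' [u'1 v'1 zuE]]] := gen_mul_left_right z u.
have [c [w [w1 vvE]]] := gen_mul_core_right v'1 v1.
exists (gen c ∗ n), u', w; split=> //.
rewrite cat_cons -cat1s word_class_cat sE core_monoid_mapM.
by rewrite -/(gen z) !mulmA zuE -(mulmA (gen u')) vvE !mulmA.
Qed.

End NormalForm.

(** * The monoid algebra *)

Section Algebra.
Variables (B : leftSemiBraceType) (rhoM : rho_antimorphism B) (K : fieldType).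
Local Open Scope ring_scope.

Lemma sm_lengthM (m n : M(B)) : sm_length (m ∗ n) = (sm_length m + sm_length n)%N.
Proof. by rewrite sm_lengthE size_cat. Qed.

Lemma core_algebra_mapU (a : K) (n : M(core rhoM)) :
  core_algebra_map rhoM K << a *g n >> = << a *g core_monoid_map rhoM n >>.
Proof.
rewrite /core_algebra_map mmapU /core_basis.
by rewrite [LHS]fgmulUU mulr1 mul1m.
Qed.

Lemma supported_from_sum (T : eqType) n (s : seq T) (F : T -> {malg K[M(B)]}) :
  (forall i, i \in s -> supported_from B K n (F i)) ->
  supported_from B K n (\sum_(i <- s) F i).
Proof.
elim: s => [_|i s IHs sF] m; first by rewrite big_nil mcoeff0 eqxx.
rewrite big_cons mcoeffD.
have [->|Fi0 _] := eqVneq (F i)@_m 0; last exact: (sF i (mem_head _ _) _ Fi0).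
rewrite add0r; apply: IHs => j sj; apply: sF.
by rewrite in_cons sj orbT.
Qed.

Lemma supported_fromM m n (x y : {malg K[M(B)]}) :
  supported_from B K m x -> supported_from B K n y ->
  supported_from B K (m + n) (x * y).
Proof.
move=> xm yn k; rewrite mcoeff_neq0 => /msuppM_le[k1 [k2 [xk1 yk2 ->]]].
by rewrite sm_lengthM leq_add ?xm ?yn ?mcoeff_neq0.
Qed.

Lemma supported_from_basis (p : {malg K[M(B)]}) :
  basis_set K (sm_setM (one_dot B) (dot_one B)) p -> supported_from B K 2 p.
Proof.
move=> [_ [x _ [y _ <-]] <-] k.
rewrite mcoeffU; have [<- _|_] := eqVneq (gen x ∗ gen y) k; last first.
  by rewrite mulr0n eqxx.
by rewrite sm_lengthM !sm_lengthE.
Qed.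

Lemma core_basisM_left (m : M(B)) (a : K) : (2 <= sm_length m)%N ->
  exists q, basis_set K (sm_setM (one_dot B) (dot_one B)) q.2 /\
    << a *g m >> = core_algebra_map rhoM K q.1 * q.2.
Proof.
case/(left_normal_form rhoM) => [n [p [pS ->]]].
exists (<< a *g n >>, << p >>); split; first by exists p.
by rewrite core_algebra_mapU [RHS]fgmulUU mulr1.
Qed.

Lemma core_basisM_right (m : M(B)) (a : K) : (2 <= sm_length m)%N ->
  exists q, basis_set K (sm_setM (one_dot B) (dot_one B)) q.2 /\
    << a *g m >> = q.2 * core_algebra_map rhoM K q.1.
Proof.
case/(right_normal_form rhoM) => [n [p [pS ->]]].
exists (<< a *g n >>, << p >>); split; first by exists p.
by rewrite core_algebra_mapU [RHS]fgmulUU mul1r.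
Qed.

(** Reduction from algebra elements to monomials. Abstracting the summand F
    lets the left and the right module share this argument. *)
Lemma supported_from_decomposition n (T : eqType) (P : T -> Prop)
    (F : T -> {malg K[M(B)]}) :
    (forall m a, (n <= sm_length m)%N -> exists q, P q /\ << a *g m >> = F q) ->
  forall x, supported_from B K n x ->
  exists s : seq T, (forall q, q \in s -> P q) /\ x = \sum_(q <- s) F q.
Proof.
move=> PF x xn; rewrite [x]monalgE.
have: forall m, m \in finmap.enum_fset (msupp x) -> (n <= sm_length m)%N.
  by move=> m xm; apply: xn; rewrite mcoeff_neq0.
elim: (finmap.enum_fset (msupp x)) => [_|m ms IHms msn].
  by exists [::]; rewrite !big_nil.
have [|s [sP sE]] := IHms.
  by move=> k ks; apply: msn; rewrite in_cons ks orbT.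
have [q [qP qE]] := PF m x@_m (msn m (mem_head _ _)).
exists (q :: s); rewrite !big_cons qE sE; split=> // r.
by rewrite in_cons => /predU1P[->|/sP].
Qed.

End Algebra.

Theorem proposition5p6 (B : leftSemiBraceType) (rhoM : rho_antimorphism B)
    (K : fieldType) :
  left_generated (core_algebra_map rhoM K)
      (basis_set K (sm_setM (one_dot B) (dot_one B)))
    = supported_from B K 2 /\
  right_generated (core_algebra_map rhoM K)
      (basis_set K (sm_setM (one_dot B) (dot_one B)))
    = supported_from B K 2.
Proof.
(* Any coefficient in KM(B) is supported in lengths >= 0, hence the bounds
   0 + 2 and 2 + 0 for the generated modules. *)
split; apply/seteqP; split=> x.
- move=> [s [sS ->]]; apply: supported_from_sum => p /sS pS.
  exact: (@supported_fromM _ _ 0 2) (supported_from_basis pS).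
- exact/supported_from_decomposition/core_basisM_left.
- move=> [s [sS ->]]; apply: supported_from_sum => p /sS pS.
  exact: (@supported_fromM _ _ 2 0) (supported_from_basis pS) _.
- exact/supported_from_decomposition/core_basisM_right.
Qed.
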